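(* Let $(W,S)$ be an irreducible Coxeter system of rank $n$, with $W$ infinite, equipped with a bilinear form $B$ of signature $(n-1,1)$. Let $\widehat{Q}$, $\widehat{\Delta}$, the normalized action $w\cdot x$, and the set $E$ of accumulation points of normalized roots be as defined in the context. Then: (a) If $\widehat{Q}\subset \mathrm{conv}(\widehat{\Delta})$, then $E=\widehat{Q}$. (b) If $\widehat{Q}\not\subset \mathrm{conv}(\widehat{\Delta})$, then $$E=\widehat{Q}\setminus\Big(\bigcup_{i=1}^m W\cdot D_i\Big),$$ where $D_1,\ldots,D_m$ are the connected components of $\widehat{Q}\setminus \mathrm{conv}(\widehat{\Delta})$, and $1\le m\le n$.
   Context: Setting: $(W,S)$ is a Coxeter system of rank $n$, $S=\{s_1,\dots,s_n\}$, with relations $(s_is_j)^{m_{ij}}=1$, $m_{ii}=1$, $m_{ij}=m_{ji}\in\mathbb{Z}_{>1}\cup\{\infty\}$ for $i\ne j$; it is irreducible if its Coxeter graph is connected. $V=\mathbb{R}^n$ is a Euclidean space with orthonormal basis $\Delta=\{\alpha_1,\dots,\alpha_n\}$ (simple roots, $\alpha_i$ corresponding to $s_i$). $B$ is a symmetric bilinear form on $V$ (identified with its matrix in the basis $\Delta$) with $B(\alpha_i,\alpha_i)=1$, $B(\alpha_i,\alpha_j)=-\cos(\pi/m_{ij})$ if $m_{ij}<\infty$, and $B(\alpha_i,\alpha_j)$ any real number $\le -1$ if $m_{ij}=\infty$. $W$ acts linearly on $V$ with $s_i$ acting as $s_{\alpha_i}(v)=v-2B(\alpha_i,v)\alpha_i$.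 The root system is $\Phi=W(\Delta)$. Normalization: since $B$ has signature $(n-1,1)$, let $o=\sum_i o_i\alpha_i$ be the eigenvector of Euclidean norm $1$ of the matrix $B$ for its negative eigenvalue with all $o_i>0$ (it exists). Put $|v|_1=\sum_i o_iv_i$ for $v=\sum_i v_i\alpha_i$, $V_0=\{v:|v|_1=0\}$, $V_1=\{v:|v|_1=1\}$, $\widehat{v}=v/|v|_1$ for $v\notin V_0$, and $\widehat{A}=\{\widehat a: a\in A\}$ for $A\subset V\setminus V_0$. Let $\widehat{Q}=\{x\in V_1: B(x,x)=0\}$. The normalized action is $w\cdot x=\widehat{w(x)}$ for $w\in W$ and $x\in V_1\setminus W(V_0)$; it is well defined on $\widehat{Q}$ and preserves it. For $D\subset \widehat{Q}$, $W\cdot D=\{w\cdot x: w\in W, x\in D\}$. All roots lie outside $V_0$, and $E$ is the set of all limits of injective sequences of normalized roots $\widehat{\rho}$, $\rho\in\Phi$. $\mathrm{conv}$ denotes convex hull. *)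

(* Defs.v *)
From HB Require Import structures.
From mathcomp Require Import all_boot all_order all_algebra.
From mathcomp Require Import all_classical all_reals all_analysis.

Set Implicit Arguments.
Unset Strict Implicit.
Unset Printing Implicit Defensive.

Import Order.TTheory GRing.Theory Num.Theory.
Import numFieldNormedType.Exports.

Local Open Scope classical_set_scope.
Local Open Scope ring_scope.

(* The entry [None] stands for m_ij = oo. *)
Record coxeter_matrix (n : nat) (m : 'I_n -> 'I_n -> option nat) : Prop :=
  CoxeterMatrix {
    coxeter_diag : forall i, m i i = Some 1%N;
    coxeter_sym : forall i j, m i j = m j i;
    coxeter_offdiag : forall i j k, i != j -> m i j = Some k -> (1 < k)%N
  }.

(* An entry m_ij = oo imposes no relation. *)
Definition coxeter_relations (n : nat) (m : 'I_n -> 'I_n -> option nat)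
    (G : groupType) (f : 'I_n -> G) : Prop :=
  forall i j k, m i j = Some k -> ((f i * f j) ^+ k = 1)%g.

(* W is the group presented by the generators s_i and the Coxeter relations:
   the universal property of the presentation, together with generation.
   The s_i being involutions, words in the s_i alone suffice. *)
Record coxeter_system (n : nat) (m : 'I_n -> 'I_n -> option nat)
    (W : groupType) (s : 'I_n -> W) : Prop :=
  CoxeterSystem {
    coxeter_system_matrix : coxeter_matrix m;
    coxeter_system_rel : coxeter_relations m s;
    coxeter_system_gen :
      forall w : W, exists l : seq 'I_n, w = (\prod_(i <- l) s i)%g;
    coxeter_system_univ :
      forall (G : groupType) (f : 'I_n -> G), coxeter_relations m f ->
      exists phi : W -> G,
        (forall x y : W, phi (x * y)%g = (phi x * phi y)%g) /\
        (forall i, phi (s i) = f i)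
  }.

Definition coxeter_edge (n : nat) (m : 'I_n -> 'I_n -> option nat) : rel 'I_n :=
  fun i j => (i != j) && (m i j != Some 2%N).

Definition irreducible_coxeter (n : nat) (m : 'I_n -> 'I_n -> option nat) : Prop :=
  forall i j : 'I_n, connect (coxeter_edge m) i j.

Section Geometry.
Context {R : realType} {n : nat}.
Implicit Types (B : 'M[R]_n) (o u v : 'rV[R]_n).

Definition bform B u v : R := (u *m B *m v^T) 0 0.

Definition simple_root (i : 'I_n) : 'rV[R]_n := delta_mx 0 i.

Definition simple_roots : set 'rV[R]_n := range simple_root.

Record coxeter_form (m : 'I_n -> 'I_n -> option nat) B : Prop :=
  CoxeterForm {
    coxeter_form_sym : B^T = B;
    coxeter_form_diag : forall i, B i i = 1;
    coxeter_form_fin : forall i j k, i != j -> m i j = Some k ->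
      B i j = - cos (pi / k%:R);
    coxeter_form_inf : forall i j, m i j = None -> B i j <= -1
  }.

(* Some basis (the rows of P) is B-orthogonal, with exactly p vectors of
   positive and q vectors of negative square. *)
Definition has_signature (p q : nat) B : Prop :=
  exists (P : 'M[R]_n) (d : 'rV[R]_n),
    [/\ P \in unitmx, P *m B *m P^T = diag_mx d,
        #|[set i | 0 < d 0 i]%SET| = p & #|[set i | d 0 i < 0]%SET| = q].

Definition simple_reflection B (i : 'I_n) v : 'rV[R]_n :=
  v - (2 * bform B (simple_root i) v) *: simple_root i.

Record geometric_action (W : groupType) (s : 'I_n -> W) B
    (act : W -> 'rV[R]_n -> 'rV[R]_n) : Prop :=
  GeometricAction {
    geometric_action1 : forall v, act 1%g v = v;
    geometric_actionM : forall x y v, act (x * y)%g v = act x (act y v);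
    geometric_action_linear : forall w, linear (act w);
    geometric_action_gen : forall i v, act (s i) v = simple_reflection B i v
  }.

Definition root_system (W : groupType) (act : W -> 'rV[R]_n -> 'rV[R]_n) :
    set 'rV[R]_n :=
  [set v | exists w : W, exists i : 'I_n, v = act w (simple_root i)].

(* B being symmetric, o *m B = a *: o says that o is an eigenvector of the
   matrix B. *)
Record normalizing_vector B o : Prop :=
  NormalizingVector {
    normalizing_eigen : exists2 a : R, a < 0 & o *m B = a *: o;
    normalizing_unit : \sum_i (o 0 i) ^+ 2 = 1;
    normalizing_pos : forall i, 0 < o 0 i
  }.

Definition o_norm o v : R := \sum_i o 0 i * v 0 i.

(* Meaningful only for o_norm o v != 0. *)
Definition hat o v : 'rV[R]_n := (o_norm o v)^-1 *: v.

Definition Qhat B o : set 'rV[R]_n :=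
  [set x | o_norm o x = 1 /\ bform B x x = 0].

Definition limit_roots (W : groupType) (act : W -> 'rV[R]_n -> 'rV[R]_n) o :
    set 'rV[R]_n :=
  [set x | exists u : nat -> 'rV[R]_n,
    [/\ injective u, (forall k, (hat o @` root_system act) (u k))
      & u k @[k --> \oo] --> x]].

Definition normalized_orbit (W : groupType)
    (act : W -> 'rV[R]_n -> 'rV[R]_n) o (D : set 'rV[R]_n) : set 'rV[R]_n :=
  [set y | exists w : W, exists2 x, D x & y = hat o (act w x)].

Definition convex_hull (A : set 'rV[R]_n) : set 'rV[R]_n :=
  [set x | exists (k : nat) (a : 'I_k -> 'rV[R]_n) (t : 'I_k -> R),
    [/\ forall i, A (a i), forall i, 0 <= t i, \sum_i t i = 1
      & x = \sum_i t i *: a i]].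

Definition connected_components (A : set 'rV[R]_n) : set (set 'rV[R]_n) :=
  connected_component A @` A.

End Geometry.

(* Main.v *)
Require Import Defs.
From HB Require Import structures.
From mathcomp Require Import all_boot all_order all_algebra.
From mathcomp Require Import all_classical all_reals all_analysis.
From mathcomp Require Import ring lra zify.

Set Implicit Arguments.
Unset Strict Implicit.
Unset Printing Implicit Defensive.

Import Order.TTheory GRing.Theory Num.Theory.
Import numFieldNormedType.Exports.

Local Open Scope classical_set_scope.
Local Open Scope ring_scope.

(** The limit roots are exactly the [x] in [Qhat] all of whose
    [W]-images have nonnegative coordinates.

    If [x] is a limit root, then [x] is isotropic because only finitely many
    positive roots have bounded height [|.|_1] (two of them that are too close
    would give a nontrivial product of reflections keeping [o] inside the open
    fundamental chamber), and every [w x] is nonnegative because each root is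
    positive or negative.

    Conversely, let all [W]-images of [x] be nonnegative.  A positive root [b]
    with [B x b >= 0] satisfies [B v v <= |b|_1 ^- 2] for [v = hat b - x], and
    [B] is positive definite on [V_0]; so [x] is a limit root as soon as there
    are infinitely many such [b].  If there were finitely many, reflecting [x] in
    a simple root [a] with [B x a > 0] would lower their number, so one reaches
    [B x a <= 0] for all simple [a].  Then [B x x = 0] forces [B x a = 0] for
    all [a] in the support of [x], and a positive root [b] of maximal height
    supported there would satisfy [B b b = 0].

    Finally [Qhat] minus the hull is the union of the [n] caps [x_i < 0] of a
    sphere centred at [o]; each cap is connected as [o_i > 0]. *)

(** * Calculus of the form, of the height and of nonnegative vectors *)

Section BilinearForm.
Context {R : realType} {n : nat}.
Implicit Types (B : 'M[R]_n) (o u v w : 'rV[R]_n).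

Lemma bformDl B u v w : bform B (u + v) w = bform B u w + bform B v w.
Proof. by rewrite /bform !mulmxDl mxE. Qed.

Lemma bformZl B a u v : bform B (a *: u) v = a * bform B u v.
Proof. by rewrite /bform -!scalemxAl mxE. Qed.

Lemma bformC B u v : B^T = B -> bform B u v = bform B v u.
Proof.
move=> hB; rewrite /bform -[in LHS](trmxK (u *m B *m v^T)) mxE.
by rewrite !trmx_mul trmxK hB mulmxA.
Qed.

Lemma bformDr B u v w : bform B w (u + v) = bform B w u + bform B w v.
Proof. by rewrite /bform linearD /= mulmxDr mxE. Qed.

Lemma bformZr B a u v : bform B u (a *: v) = a * bform B u v.
Proof. by rewrite /bform linearZ /= -scalemxAr mxE. Qed.

Lemma bformNl B u v : bform B (- u) v = - bform B u v.
Proof. by rewrite -scaleN1r bformZl mulN1r. Qed.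

Lemma bformNr B u v : bform B v (- u) = - bform B v u.
Proof. by rewrite -scaleN1r bformZr mulN1r. Qed.

Lemma bform_suml B u v :
  bform B u v = \sum_i u 0 i * bform B (simple_root i) v.
Proof.
rewrite {1}/bform -mulmxA mxE; apply: eq_bigr => i _; congr (_ * _).
by rewrite /bform /simple_root -mulmxA -rowE [RHS]mxE.
Qed.

Lemma bform_simple_roots B i j :
  bform B (simple_root i) (simple_root j) = B i j.
Proof.
by rewrite /bform /simple_root -rowE trmx_delta -colE !mxE.
Qed.

Lemma bform_simple_root B i v :
  bform B (simple_root i) v = \sum_j B i j * v 0 j.
Proof.
rewrite /bform /simple_root -rowE mxE.
by apply: eq_bigr => j _; rewrite !mxE.
Qed.

Lemma o_normD o u v : o_norm o (u + v) = o_norm o u + o_norm o v.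
Proof.
by rewrite /o_norm -big_split; apply: eq_bigr => i _; rewrite mxE mulrDr.
Qed.

Lemma o_normZ o a v : o_norm o (a *: v) = a * o_norm o v.
Proof.
by rewrite /o_norm mulr_sumr; apply: eq_bigr => i _; rewrite mxE; ring.
Qed.

Lemma o_normN o v : o_norm o (- v) = - o_norm o v.
Proof. by rewrite -scaleN1r o_normZ mulN1r. Qed.

Lemma o_norm_simple_root o i : o_norm o (simple_root i) = o 0 i.
Proof.
rewrite /o_norm (bigD1 i) //= big1 ?addr0 => [|j /negPf ji];
  by rewrite !mxE !eqxx ?ji ?mulr1 ?mulr0.
Qed.

(** Provides the constant for the perturbation estimate in [close_posroot_eq]; the added 1 makes it
    strictly positive. *)
Lemma bform_bound B : exists2 C : R, 0 < C & forall u v a b,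
  0 <= a -> 0 <= b -> (forall i, `|u 0 i| <= a) -> (forall i, `|v 0 i| <= b) ->
  `|bform B u v| <= C * a * b.
Proof.
exists (1 + \sum_i \sum_j `|B i j|).
  by rewrite ltr_pwDl // sumr_ge0 // => i _; rewrite sumr_ge0.
move=> u v a b a0 b0 ua vb.
apply: (@le_trans _ _ ((\sum_i \sum_j `|B i j|) * a * b)); last first.
  by rewrite -!mulrA ler_wpM2r ?mulr_ge0 // ler_wpDl.
rewrite bform_suml (le_trans (ler_norm_sum _ _ _)) // !mulr_suml.
apply: ler_sum => i _; rewrite normrM -mulrA mulrCA; apply: ler_pM => //.
rewrite bform_simple_root (le_trans (ler_norm_sum _ _ _)) // mulr_suml.
by apply: ler_sum => j _; rewrite normrM ler_wpM2l.
Qed.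

Definition nonneg v := forall i, 0 <= v 0 i.

Lemma nonnegD u v : nonneg u -> nonneg v -> nonneg (u + v).
Proof. by move=> hu hv i; rewrite mxE addr_ge0. Qed.

Lemma nonnegZ a v : 0 <= a -> nonneg v -> nonneg (a *: v).
Proof. by move=> a0 hv i; rewrite mxE mulr_ge0. Qed.

Lemma simple_root_nonneg i : nonneg (simple_root i : 'rV[R]_n).
Proof. by move=> j; rewrite mxE /= ler0n. Qed.

End BilinearForm.

(** * Coordinatewise convergence of row vectors *)

Section Limits.
Context {R : realType} {n : nat} {T : Type} (F : set_system T) {FF : Filter F}.

Lemma cvg_sum_seq (I : Type) (r : seq I) (f : I -> T -> R) (l : I -> R) :
  (forall i, f i t @[t --> F] --> l i) ->
  \sum_(i <- r) f i t @[t --> F] --> \sum_(i <- r) l i.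
Proof.
move=> fl; elim: r => [|i r IH].
  by rewrite big_nil; under eq_fun do rewrite big_nil; exact: cvg_cst.
by rewrite big_cons; under eq_fun do rewrite big_cons; exact: cvgD.
Qed.

Lemma cvg_rowP (u : T -> 'rV[R]_n) (v : 'rV[R]_n) :
  u t @[t --> F] --> v <-> forall i, u t 0 i @[t --> F] --> v 0 i.
Proof.
split=> [uv i|uv].
  have := @continuous_cvg _ _ _ F FF u (fun w : 'rV[R]_n => w 0 i) v.
  by apply => //; exact: coord_continuous.
apply/cvg_ballP => e e0.
have : \forall t \near F, forall i, ball (v 0 i) e (u t 0 i).
  apply: filter_forall => i; move/cvg_ballP : (uv i); exact.
apply: filterS => t h; split=> // i j.
by rewrite (ord1 i).
Qed.

Lemma cvg_bform (B : 'M[R]_n) (u : T -> 'rV[R]_n) (v : 'rV[R]_n) :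
  u t @[t --> F] --> v -> bform B (u t) (u t) @[t --> F] --> bform B v v.
Proof.
move=> /cvg_rowP uv; rewrite bform_suml; under eq_fun do rewrite bform_suml.
apply: cvg_sum_seq => i; apply: cvgM => //.
rewrite bform_simple_root; under eq_fun do rewrite bform_simple_root.
by apply: cvg_sum_seq => j; apply: cvgM => //; exact: cvg_cst.
Qed.

Lemma cvg_o_norm (o : 'rV[R]_n) (u : T -> 'rV[R]_n) (v : 'rV[R]_n) :
  u t @[t --> F] --> v -> o_norm o (u t) @[t --> F] --> o_norm o v.
Proof.
move=> /cvg_rowP uv; apply: cvg_sum_seq => i.
by apply: cvgM => //; exact: cvg_cst.
Qed.

End Limits.

(** * Lorentzian geometry: the form is positive definite on [V_0] *)

Section Lorentzian.
Context {R : realType} {n : nat} (B : 'M[R]_n) (o : 'rV[R]_n).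
Context (symB : B^T = B) (hsig : has_signature n.-1 1 B)
  (ho : normalizing_vector B o).
Implicit Types (u v x y z : 'rV[R]_n).

Lemma o_norm_o : o_norm o o = 1.
Proof. by rewrite -(normalizing_unit ho); apply: eq_bigr => i _; rewrite expr2. Qed.

(** As [o] is a unit eigenvector, its eigenvalue is [bform B o o]. Hence [V_0] is the B-orthogonal
    complement of [o]. *)
Lemma bform_o v : bform B o v = bform B o o * o_norm o v.
Proof.
have [a _ oB] := normalizing_eigen ho.
have aux u : bform B o u = a * o_norm o u.
  rewrite /bform oB -scalemxAl mxE /o_norm mxE; congr (_ * _).
  by apply: eq_bigr => i _; rewrite mxE.
by rewrite !aux o_norm_o mulr1.
Qed.

Lemma bform_oo_lt0 : bform B o o < 0.
Proof.
have [a a0 oB] := normalizing_eigen ho.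
rewrite /bform oB -scalemxAl mxE.
have -> : (o *m o^T) 0 0 = 1.
  by rewrite -o_norm_o mxE; apply: eq_bigr => i _; rewrite mxE.
by rewrite mulr1.
Qed.

Lemma signature_basis : exists (P : 'M[R]_n) (d : 'rV[R]_n) (j : 'I_n),
  [/\ P \in unitmx, P *m B *m P^T = diag_mx d, d 0 j < 0
    & forall i, i != j -> 0 < d 0 i].
Proof.
have [P [d [Pu PB cp cn]]] := hsig.
have /cards1P[j dj] : #|[set i | d 0 i < 0]%SET| == 1%N by rewrite cn.
have jN : d 0 j < 0 by have := set11 j; rewrite -dj inE.
exists P, d, j; split=> // i ij.
(* Both sets have [n.-1] elements, so the inclusion is an equality and no [d 0 i] vanishes. *)
have sub : [set i | 0 < d 0 i]%SET \subset [set~ j]%SET.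
  apply/fintype.subsetP => k; rewrite !inE => dk; apply/eqP => kj.
  by rewrite kj ltNge ltW in dk.
have : [set i | 0 < d 0 i]%SET == [set~ j]%SET.
  by rewrite eqEcard sub cp cardsC1 card_ord leqnn.
by move/eqP/setP/(_ i); rewrite !inE ij => ->.
Qed.

Lemma bform_unit : B \in unitmx.
Proof.
have [P [d [j [Pu PB dj d0]]]] := signature_basis.
have : diag_mx d \in unitmx.
  rewrite unitmxE det_diag unitfE; apply/prodf_neq0 => i _.
  by have [->|/d0/gt_eqF->//] := eqVneq i j; rewrite lt_eqF.
by rewrite -PB !unitmx_mul => /andP[/andP[]].
Qed.

(** Let [c] be the coordinate along the negative direction of a diagonalizing basis; the form is
    positive definite on the kernel of [c]. The combination of [o] and [v] killed by [c] has
    nonpositive square, as [o] and [v] are orthogonal, so it is zero. Its height then gives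
    [c v = 0], and [v] is zero too. *)
Lemma bform_V0_anisotropic v : o_norm o v = 0 -> bform B v v <= 0 -> v = 0.
Proof.
move=> v0 vN.
have [P [d [j [Pu PB dj dpos]]]] := signature_basis.
pose c u := (u *m invmx P) 0 j.
have posP u : c u = 0 -> bform B u u <= 0 -> u = 0.
  rewrite /c; move: (u *m invmx P) (mulmxKV Pu u) => y yu yj.
  have -> : bform B u u = \sum_i d 0 i * y 0 i ^+ 2.
    rewrite -yu /bform trmx_mul -!mulmxA (mulmxA B) (mulmxA P) (mulmxA P) PB mxE.
    apply: eq_bigr => i _; rewrite mul_diag_mx !mxE; ring.
  move=> le0; suff y0 : y = 0 by rewrite -yu y0 mul0mx.
  have t0 i : 0 <= d 0 i * y 0 i ^+ 2.
    have [->|/dpos/ltW ?] := eqVneq i j; first by rewrite yj expr2 !mulr0.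
    by rewrite mulr_ge0 ?sqr_ge0.
  have : \sum_i d 0 i * y 0 i ^+ 2 == 0 by rewrite eq_le le0 sumr_ge0.
  rewrite psumr_eq0 // => /allP s0; apply/rowP => i; rewrite mxE.
  have [->//|/dpos di] := eqVneq i j.
  have := s0 i (mem_index_enum _); rewrite mulf_eq0 gt_eqF //= sqrf_eq0.
  by move/eqP.
have cD u w t s : c (t *: u + s *: w) = t * c u + s * c w.
  by rewrite /c mulmxDl -!scalemxAl !mxE.
have onz : o != 0.
  by apply/eqP => oz; have := bform_oo_lt0; rewrite oz /bform mul0mx mul0mx mxE ltxx.
have co : c o != 0.
  apply/eqP => co0; move/eqP: onz; apply; apply: posP => //.
  exact: ltW bform_oo_lt0.
pose u := c v *: o + (- c o) *: v.
have u0 : u = 0.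
  apply: posP; first by rewrite cD; ring.
  rewrite !(bformDl, bformDr, bformZl, bformZr) (bformC v o symB) !(bform_o v) v0.
  have h1 := sqr_ge0 (c v); have h2 := sqr_ge0 (c o); have h3 := bform_oo_lt0.
  nra.
have cv : c v = 0.
  have : o_norm o u = 0 by rewrite u0 /o_norm big1 // => i _; rewrite mxE mulr0.
  by rewrite o_normD !o_normZ o_norm_o v0 mulr0 mulr1 addr0.
move/eqP: u0; rewrite /u cv scale0r add0r scaler_eq0 oppr_eq0 (negPf co) /=.
by move/eqP.
Qed.

Lemma bform_V0_nonneg v : o_norm o v = 0 -> 0 <= bform B v v.
Proof.
move=> v0; rewrite leNgt; apply/negP => neg.
move: (neg); rewrite (bform_V0_anisotropic v0 (ltW neg)) /bform mul0mx mul0mx mxE.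
by rewrite ltxx.
Qed.

Lemma bform_V0_cauchy u v : o_norm o u = 0 -> o_norm o v = 0 ->
  bform B u v ^+ 2 <= bform B u u * bform B v v.
Proof.
move=> u0 v0; have [uz|unz] := eqVneq u 0.
  by rewrite uz /bform !mul0mx !mxE mul0r expr2 mul0r.
have up : 0 < bform B u u.
  by rewrite ltNge; apply/negP => /(bform_V0_anisotropic u0)/eqP; rewrite (negPf unz).
have w0 : o_norm o (bform B u u *: v + (- bform B u v) *: u) = 0.
  by rewrite o_normD !o_normZ u0 v0; ring.
have := bform_V0_nonneg w0.
rewrite !(bformDl, bformDr, bformZl, bformZr) (bformC v u symB) => h.
rewrite -subr_ge0 -(pmulr_rge0 _ up); apply: le_trans h _.
by rewrite le_eqVlt; apply/orP; left; apply/eqP; ring.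
Qed.

(* Cauchy-Schwarz against the projection to [V_0] of the [i]-th dual vector. *)
Lemma coord_V0_bound : exists c : R, 0 < c /\
  forall v i, o_norm o v = 0 -> v 0 i ^+ 2 <= c * bform B v v.
Proof.
pose dual i := simple_root i *m invmx B : 'rV[R]_n.
pose p i := dual i + (- o_norm o (dual i)) *: o.
have p0 i : o_norm o (p i) = 0 by rewrite o_normD o_normZ o_norm_o; ring.
have vp i v : o_norm o v = 0 -> bform B (p i) v = v 0 i.
  move=> v0; rewrite bformDl bformZl bform_o v0 !mulr0 addr0.
  by rewrite /bform /dual mulmxKV ?bform_unit // -rowE !mxE.
exists (1 + \sum_i bform B (p i) (p i)).
have nn i : 0 <= bform B (p i) (p i) by exact: bform_V0_nonneg.
split; first by rewrite ltr_pwDl ?sumr_ge0.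
move=> v i v0; rewrite -(vp i v v0).
apply: le_trans (bform_V0_cauchy (p0 i) v0) _.
rewrite ler_wpM2r ?bform_V0_nonneg // (bigD1 i) //=.
by rewrite addrCA lerDl addr_ge0 ?sumr_ge0.
Qed.

(** * The hull of the normalized simple roots and the caps outside it *)

Let opos i : 0 < o 0 i := normalizing_pos ho i.

(** The barycentric coordinates of [x] with respect to the normalized simple roots are the
    [o 0 i * x 0 i], whose sum is [o_norm o x]. *)
Lemma convex_hullP x : o_norm o x = 1 ->
  convex_hull (hat o @` simple_roots) x <-> nonneg x.
Proof.
move=> ox; split=> [[k [a [t [aP t0 _ ->]]]] j|xnn].
  rewrite summxE; apply: sumr_ge0 => i _; rewrite mxE mulr_ge0 //.
  have [_ [l _ <-] <-] := aP i.
  by rewrite mxE o_norm_simple_root mulr_ge0 ?invr_ge0 ?(ltW (opos l)) ?simple_root_nonneg.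
exists n, (fun i => hat o (simple_root i)), (fun i => o 0 i * x 0 i); split=> //.
- by move=> i; exists (simple_root i) => //; exists i.
- by move=> i; rewrite mulr_ge0 ?(ltW (opos i)).
rewrite [LHS]row_sum_delta; apply: eq_bigr => i _.
rewrite /hat o_norm_simple_root scalerA mulrAC mulfV ?mul1r //.
by rewrite gt_eqF.
Qed.

Definition cap i := [set x | Qhat B o x /\ x 0 i < 0].

(* [Qhat] is a sphere of centre [o] for the Euclidean norm defined by [B] on
   [V_0], and [cap i] lies strictly on one side of [o]: projecting the segment
   [x, y] radially onto the sphere does not leave the cap. *)
Lemma cap_path i x y : cap i x -> cap i y ->
  exists2 C, connected C & [/\ C x, C y & C `<=` cap i].
Proof.
move=> [[ox x0] xi] [[oy y0] yi].
have oi := opos i.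
pose A := - bform B o o; have A0 : 0 < A by rewrite oppr_gt0 (bform_oo_lt0).
have shift v : o_norm o v = 1 -> bform B v v = 0 ->
    o_norm o (v - o) = 0 /\ bform B (v - o) (v - o) = A.
  move=> ov v0; split; first by rewrite o_normD o_normN ov (o_norm_o) subrr.
  rewrite !(bformDl, bformDr, bformNl, bformNr) v0 (bformC v o symB).
  by rewrite [bform B o v](bform_o) ov /A; ring.
have [p0 pA] := shift x ox x0; have [p'0 p'A] := shift y oy y0.
have pi : (x - o) 0 i < - o 0 i by rewrite !mxE; lra.
have p'i : (y - o) 0 i < - o 0 i by rewrite !mxE; lra.
have xE : x = o + (x - o) by rewrite addrCA subrr addr0.
have yE : y = o + (y - o) by rewrite addrCA subrr addr0.
move: (x - o) (y - o) p0 pA p'0 p'A pi p'i xE yE => p p' p0 pA p'0 p'A pi p'i xE yE.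
pose z t := (1 - t) *: p + t *: p'.
pose q t := bform B (z t) (z t).
(* The factor [c t] moves the chord point [z t] onto the sphere of squared radius [A]. The chord
   lies in the ball, so [1 <= c t], and stretching keeps the [i]-th coordinate below [- o 0 i]. *)
pose c t := Num.sqrt A / Num.sqrt (q t).
pose f (t : R) : 'rV[R]_n := o + c t *: z t.
have z0 t : o_norm o (z t) = 0 by rewrite o_normD !o_normZ p0 p'0; ring.
have zi t : 0 <= t <= 1 -> z t 0 i < - o 0 i.
  move=> /andP[t0 t1]; rewrite !mxE.
  have h1 : 0 <= (1 - t) * (- o 0 i - p 0 i) by rewrite mulr_ge0 //; lra.
  have [->|tn] := eqVneq t 0; first by lra.
  have h2 : 0 < t * (- o 0 i - p' 0 i).
    by rewrite mulr_gt0 ?lt_neqAle 1?eq_sym ?tn //; lra.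
  lra.
have q0 t : 0 <= t <= 1 -> 0 < q t.
  move=> t01; rewrite ltNge; apply/negP => /(bform_V0_anisotropic (z0 t)) zt.
  by have := zi t t01; rewrite zt mxE; lra.
have qA t : 0 <= t <= 1 -> q t <= A.
  move=> /andP[t0 t1].
  have : 0 <= bform B (p - p') (p - p').
    by apply: (bform_V0_nonneg); rewrite o_normD o_normN p0 p'0 subrr.
  rewrite /q /z !(bformDl, bformDr, bformNl, bformNr, bformZl, bformZr) pA p'A.
  by rewrite (bformC p' p symB); have := mulr_ge0 t0 (_ : 0 <= 1 - t); nra.
have c1 t : 0 <= t <= 1 -> 1 <= c t.
  move=> t01; rewrite ler_pdivlMr ?sqrtr_gt0 ?q0 // mul1r ler_wsqrtr //.
  exact: qA.
have cq t : 0 <= t <= 1 -> c t * c t * q t = A.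
  move=> t01; rewrite -expr2 /c expr_div_n !sqr_sqrtr ?ltW ?q0 //.
  by rewrite divfK // gt_eqF // q0.
exists (f @` `[0, 1]).
  apply: connected_continuous_connected; first exact: segment_connected.
  apply: continuous_in_subspaceT => t; rewrite inE /= in_itv /= => t01.
  have zcvg : z t' @[t' --> t] --> z t.
    apply/cvg_rowP => j; rewrite /z !mxE; under eq_fun do rewrite !mxE.
    apply: cvgD; (apply: cvgM; last exact: cvg_cst); last exact: cvg_id.
    by apply: cvgB; [exact: cvg_cst|exact: cvg_id].
  have ccvg : c t' @[t' --> t] --> c t.
    apply: cvgM; first exact: cvg_cst.
    apply: cvgV; first by rewrite gt_eqF // sqrtr_gt0 q0.
    apply: continuous_cvg; first exact: sqrt_continuous.
    exact: cvg_bform.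
  apply/cvg_rowP => j; rewrite !mxE; under eq_fun do rewrite !mxE.
  apply: cvgD; first exact: cvg_cst.
  apply: cvgM => //; move/cvg_rowP : zcvg => /(_ j).
  by rewrite !mxE; under eq_fun do rewrite !mxE.
have sA : c 0 = 1 /\ c 1 = 1.
  rewrite /c /q /z subr0 subrr !scale0r !scale1r addr0 add0r pA p'A.
  by rewrite divff // gt_eqF // sqrtr_gt0.
split.
- exists 0; first by rewrite /= in_itv /= lexx ler01.
  by rewrite /f sA.1 /z subr0 !scale1r scale0r addr0.
- exists 1; first by rewrite /= in_itv /= lexx ler01.
  by rewrite /f sA.2 /z subrr !scale1r scale0r add0r.
move=> _ [t + <-]; rewrite /= in_itv /= /f => t01.
move: (z0 t) (zi t t01) (c1 t t01) (cq t t01); rewrite /q.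
move: (z t) (c t) => v a v0 vi a1 aA; split; last by rewrite !mxE; nra.
split; first by rewrite o_normD o_normZ (o_norm_o) v0 mulr0 addr0.
rewrite !(bformDl, bformDr, bformZl, bformZr) (bformC v o symB).
by rewrite (bform_o v) v0 (mulrA a a) aA /A; ring.
Qed.

Lemma cap_component (S : set 'rV[R]_n) i x y : cap i `<=` S ->
  cap i x -> cap i y -> connected_component S x = connected_component S y.
Proof.
move=> capS xi yi; have [C connC [Cx Cy Ccap]] := cap_path xi yi.
apply: same_connected_component.
by apply: (@connected_component_max _ S C x) => //; exact: subset_trans capS.
Qed.

(** A point outside the hull has a negative coordinate, so it lies in a cap, and one point per
    nonempty cap represents every component. Several caps may share a component, hence [undup]. *)
Lemma components_outside_hull
    (S := Qhat B o `\` convex_hull (hat o @` simple_roots)) :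
  exists (k : nat) (D : 'I_k -> set 'rV[R]_n),
    [/\ (k <= n)%N, injective D & range D = connected_components S].
Proof.
have capS i : cap i `<=` S.
  move=> x [Qx xi]; split=> // /(convex_hullP Qx.1)/(_ i).
  by rewrite leNgt xi.
(* The default [o] is returned only for an empty cap, and those are filtered out of [l]. *)
pose pt i := xget o (cap i).
pose l := undup [seq connected_component S (pt i) |
  i <- enum 'I_n & `[< cap i !=set0 >]].
have ptP i : cap i !=set0 -> cap i (pt i).
  by move=> [x ix]; exact: (xgetPex o (ex_intro _ x ix)).
have lP C : C \in l <-> connected_components S C.
  rewrite mem_undup; split=> [/mapP[i]|[x Sx <-]].
    rewrite mem_filter => /andP[/asboolP/ptP ipt _] ->.
    by exists (pt i) => //; exact: capS ipt.
  have [i xi] : exists i, x 0 i < 0.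
    apply: contrapT => h; case: Sx => Qx; apply; apply/(convex_hullP Qx.1) => i.
    by rewrite leNgt; apply/negP => ?; apply: h; exists i.
  have cx : cap i x by split=> //; case: Sx.
  have ci : cap i !=set0 by exists x.
  apply/mapP; exists i; last by apply: cap_component (capS i) cx (ptP i ci).
  by rewrite mem_filter mem_enum andbT; apply/asboolP.
exists (size l), (fun i => nth set0 l i); split.
- apply: leq_trans (size_undup _) _; rewrite size_map size_filter.
  by apply: leq_trans (count_size _ _) _; rewrite size_enum_ord.
- move=> i j /eqP; rewrite nth_uniq ?undup_uniq //.
  by move=> /eqP ij; apply/val_inj.
apply/seteqP; split=> [C [i _ <-]|C /lP Cl]; first by apply/lP/mem_nth.
have Cn : (index C l < size l)%N by rewrite index_mem.
by exists (Ordinal Cn) => //=; rewrite nth_index.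
Qed.

End Lorentzian.

(** * Alternating words in two involutions *)

Section Alternating.
Context {G : groupType}.
Implicit Types (x y : G).
Local Open Scope group_scope.

(* The alternating product of [k] letters, [y] being the rightmost one. *)
Fixpoint alt x y (k : nat) : G :=
  if k is k'.+1 then (if odd k' then x else y) * alt x y k' else 1.

Lemma altSr x y k : alt x y k.+1 = alt y x k * y.
Proof.
elim: k => [|k IH]; first by rewrite /= mul1g mulg1.
rewrite -[alt x y k.+2]/((if odd k.+1 then x else y) * alt x y k.+1) IH mulgA.
by rewrite /=; case: (odd k).
Qed.

(** For involutions, the quotient of the two alternating words of length [j] is the [j]-th power of
    [x * y] or of [y * x], according to the parity of [j]. *)
Lemma alt_braid x y k : x * x = 1 -> y * y = 1 ->
  (x * y) ^+ k = 1 -> (y * x) ^+ k = 1 -> alt x y k = alt y x k.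
Proof.
move=> xx yy xyk yxk.
have xV : x^-1 = x by apply: (mulgI x); rewrite mulgV xx.
have yV : y^-1 = y by apply: (mulgI y); rewrite mulgV yy.
have swap a b j : a * (b * a) ^+ j = (a * b) ^+ j * a :> G.
  elim: j => [|j IH]; first by rewrite mulg1 mul1g.
  by rewrite !expgS -!mulgA IH.
have key j : alt x y j * (alt y x j)^-1 =
    if odd j then (y * x) ^+ j else (x * y) ^+ j.
  elim: j => [|j IH]; first by rewrite /= mul1g invg1.
  rewrite /= invgM mulgA -(mulgA _ _ (alt y x j)^-1) IH.
  by case: (odd j) => /=; rewrite ?xV ?yV swap -mulgA -expgSr.
apply: (mulIg (alt y x k)^-1); rewrite key mulgV.
by case: ifP.
Qed.

End Alternating.

(** * Signs of the Chebyshev values that occur in rank two *)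

Section Chebyshev.
Context {R : realType}.
Implicit Types (c : R).

(* [cheb c k] is the pair (U_k, U_(k+1)) of Chebyshev values of the second kind
   at [c], shifted so that U_0 = 0 and U_1 = 1. *)
Fixpoint cheb c (k : nat) : R * R :=
  if k is k'.+1 then ((cheb c k').2, 2 * c * (cheb c k').2 - (cheb c k').1)
  else (0, 1).

Lemma cheb_ge1 c k : 1 <= c -> 0 <= (cheb c k).1 <= (cheb c k).2.
Proof.
move=> c1; elim: k => [|k /andP[h1 h2]] /=; first by rewrite lexx ler01.
by apply/andP; split; nra.
Qed.

Lemma cheb_sin (t : R) k :
  (cheb (cos t) k).1 * sin t = sin (k%:R * t) /\
  (cheb (cos t) k).2 * sin t = sin (k.+1%:R * t).
Proof.
elim: k => [|k [h1 h2]] /=; first by rewrite !mul0r sin0 !mul1r.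
split=> //; rewrite mulrBl -(mulrA _ _ (sin t)) h2 h1.
have e1 : k.+2%:R * t = k.+1%:R * t + t by rewrite -[k.+2%:R]natr1; ring.
have e2 : k%:R * t = k.+1%:R * t - t by rewrite -[k.+1%:R]natr1; ring.
by rewrite e2 sinB e1 sinD; ring.
Qed.

(** By [cheb_sin] the two values are sines of [k * pi / M] and [k.+1 * pi / M] over a positive sine,
    and [k < M] keeps both angles in [[0, pi]]. *)
Lemma cheb_cos_ge0 (M k : nat) : (1 < M)%N -> (k < M)%N ->
  0 <= (cheb (cos (pi / M%:R : R)) k).1 /\ 0 <= (cheb (cos (pi / M%:R : R)) k).2.
Proof.
move=> M1 kM; set t : R := pi / M%:R.
have M0 : 0 < M%:R :> R by rewrite ltr0n; lia.
have t0 : 0 < t by rewrite divr_gt0 // pi_gt0.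
have sin_ge0 j : (j <= M)%N -> 0 <= sin (j%:R * t).
  move=> jM; apply: sin_ge0_pi; rewrite mulr_ge0 ?ler0n ?(ltW t0) //=.
  rewrite /t mulrA mulrAC ler_piMl ?pi_ge0 //.
  by rewrite ler_pdivrMr // mul1r ler_nat.
have st : 0 < sin t.
  apply: sin_gt0_pi; rewrite t0 /=.
  by rewrite /t ltr_pdivrMr // -[ltLHS]mulr1 ltr_pM2l ?pi_gt0 // ltr1n.
have [h1 h2] := cheb_sin t k.
by split; rewrite -(pmulr_lge0 _ st) ?h1 ?h2 sin_ge0 // ltnW.
Qed.

End Chebyshev.

(** Serves to pick a root of maximal height among those supported where a given vector is
    positive. *)
Lemma seq_argmax {R : realType} (T : eqType) (f : T -> R) (P : T -> Prop)
    (l : seq T) : (exists2 v, v \in l & P v) ->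
  exists2 v, P v & forall u, u \in l -> P u -> f u <= f v.
Proof.
elim: l => [[v //]|a l IH [v]]; rewrite inE => vl Pv.
have [[u ul Pu]|none] := pselect (exists2 u, u \in l & P u).
  have [b Pb bmax] := IH (ex_intro2 _ _ u ul Pu).
  have [[Pa fa]|h] := pselect (P a /\ f b <= f a).
    exists a => // c; rewrite inE => /orP[/eqP->//|cl Pc].
    exact: le_trans (bmax _ cl Pc) fa.
  exists b => // c; rewrite inE => /orP[/eqP-> Pa|]; last exact: bmax.
  by rewrite leNgt; apply/negP => lt; apply: h; split=> //; exact: ltW.
have only u : u \in a :: l -> P u -> u = v.
  have va : v = a by case/orP: vl => [/eqP//|vl]; case: none; exists v.
  rewrite inE va => /orP[/eqP//|ul Pu]; by case: none; exists u.
by exists v => // u ul Pu; rewrite (only u ul Pu).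
Qed.

(** * The action of [W] and the length function *)

Section LimitRoots.
Context {R : realType} {n : nat} {m : 'I_n -> 'I_n -> option nat}
  {W : groupType} {s : 'I_n -> W} {B : 'M[R]_n}
  {act : W -> 'rV[R]_n -> 'rV[R]_n} {o : 'rV[R]_n}.
Context (hW : coxeter_system m s) (hB : coxeter_form m B)
  (hsig : has_signature n.-1 1 B) (hact : geometric_action s B act)
  (ho : normalizing_vector B o).
Implicit Types (u v x : 'rV[R]_n) (w : W).

Let symB : B^T = B := coxeter_form_sym hB.
Let opos i : 0 < o 0 i := normalizing_pos ho i.

Lemma gen_sqr i : (s i * s i = 1)%g.
Proof.
have := coxeter_system_rel hW (coxeter_diag (coxeter_system_matrix hW) i).
by rewrite expg1.
Qed.

Lemma mulgenK w i : (w * s i * s i = w)%g.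
Proof. by rewrite -mulgA gen_sqr mulg1. Qed.

Lemma actD w u v : act w (u + v) = act w u + act w v.
Proof. by have := geometric_action_linear hact w 1 u v; rewrite !scale1r. Qed.

Lemma act0 w : act w 0 = 0.
Proof. by apply: (addrI (act w 0)); rewrite -actD !addr0. Qed.

Lemma actZ w a v : act w (a *: v) = a *: act w v.
Proof.
by have := geometric_action_linear hact w a v 0; rewrite !addr0 act0 addr0.
Qed.

Lemma actN w v : act w (- v) = - act w v.
Proof. by rewrite -scaleN1r actZ scaleN1r. Qed.

Lemma act_gen i v :
  act (s i) v = v - (2 * bform B (simple_root i) v) *: simple_root i.
Proof. exact: geometric_action_gen hact i v. Qed.

Lemma actK w v : act (w^-1)%g (act w v) = v.
Proof. by rewrite -(geometric_actionM hact) mulVg (geometric_action1 hact). Qed.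

Lemma actVK w v : act w (act (w^-1)%g v) = v.
Proof. by rewrite -(geometric_actionM hact) mulgV (geometric_action1 hact). Qed.

Lemma bform_simple_root1 i : bform B (simple_root i) (simple_root i) = 1.
Proof. by rewrite bform_simple_roots (coxeter_form_diag hB). Qed.

Lemma act_gen_simple i : act (s i) (simple_root i) = - simple_root i.
Proof.
rewrite act_gen bform_simple_root1 mulr1 scaler_nat mulr2n opprD addrA subrr.
by rewrite sub0r.
Qed.

Lemma gen_ind (P : W -> Prop) :
  P 1%g -> (forall i w, P w -> P (s i * w)%g) -> forall w, P w.
Proof.
move=> P1 PS w; have [l ->] := coxeter_system_gen hW w.
by elim: l => [|i l IH]; rewrite ?big_nil // big_cons; exact: PS.
Qed.

Lemma bform_act w u v : bform B (act w u) (act w v) = bform B u v.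
Proof.
elim/gen_ind: w u v => [|i w IH] u v; first by rewrite !(geometric_action1 hact).
rewrite !(geometric_actionM hact) !act_gen -[RHS]IH.
move: (act w u) (act w v) => {}u {}v.
rewrite !(bformDl, bformDr, bformNl, bformNr, bformZl, bformZr).
by rewrite bform_simple_root1 (bformC u (simple_root i) symB); ring.
Qed.

Lemma word_exists w :
  exists k, `[< exists2 l : seq 'I_n, size l = k & w = (\prod_(i <- l) s i)%g >].
Proof.
have [l wl] := coxeter_system_gen hW w.
by exists (size l); apply/asboolP; exists l.
Qed.

Definition len w : nat := ex_minn (word_exists w).

Lemma len_word w :
  exists2 l : seq 'I_n, size l = len w & w = (\prod_(i <- l) s i)%g.
Proof. by rewrite /len; case: ex_minnP => k /asboolP. Qed.

Lemma len_le (l : seq 'I_n) : (len (\prod_(i <- l) s i)%g <= size l)%N.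
Proof.
by rewrite /len; case: ex_minnP => k _; apply; apply/asboolP; exists l.
Qed.

Lemma len_gen w i : (len (w * s i)%g <= (len w).+1)%N.
Proof.
have [l <- ->] := len_word w.
by have := len_le (rcons l i); rewrite big_rcons /= size_rcons.
Qed.

Lemma len_gt0 w : (0 < len w)%N ->
  exists i (v : W), w = (v * s i)%g /\ (len v < len w)%N.
Proof.
move=> w0; have [l] := len_word w; case/lastP: l => [/= sz|l i].
  by rewrite -sz in w0.
rewrite size_rcons big_rcons /= => /esym sz wE.
by exists i, (\prod_(j <- l) s j)%g; rewrite sz ltnS len_le.
Qed.

Lemma len_alt w i j k :
  (len (w * alt (s i) (s j) k)%g <= len w + k)%N.
Proof.
elim: k w => [|k IH] w; first by rewrite /= mulg1 addn0.
rewrite /= mulgA; apply: leq_trans (IH _) _; rewrite addnS -addSn leq_add2r.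
by case: (odd k); exact: len_gen.
Qed.

(** In the plane of the two simple roots, each further reflection performs one step of the
    recurrence of [cheb] at [- B i j] on the coefficients. *)
Lemma act_alt i j k :
  act (alt (s i) (s j) k) (simple_root i) =
    (cheb (- B i j) k).2 *: simple_root (if odd k then j else i) +
    (cheb (- B i j) k).1 *: simple_root (if odd k then i else j).
Proof.
have Bji : B j i = B i j by rewrite -[in LHS]symB mxE.
elim: k => [|k IH].
  by rewrite /= (geometric_action1 hact) scale1r scale0r addr0.
rewrite /= (geometric_actionM hact) IH.
have reflect (p q : 'I_n) (a b : R) : B p q = B i j ->
    act (s p) (a *: simple_root q + b *: simple_root p) =
    (2 * (- B i j) * a - b) *: simple_root p + a *: simple_root q.
  move=> e; rewrite act_gen bformDr !bformZr bform_simple_root1.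
  by rewrite bform_simple_roots e; apply/rowP => ?; rewrite !mxE; ring.
by case: (odd k) => /=; rewrite reflect.
Qed.

(* Write [w] as [v] times an alternating word in [s i], [s j], as long as the
   lengths allow: then [v] is shorter than [v * s i] and [v * s j], and the
   alternating word acts in the plane of the two simple roots. *)
Lemma act_simple_nonneg w i :
  (len w <= len (w * s i)%g)%N -> nonneg (act w (simple_root i)).
Proof.
have [N] := ubnP (len w); elim: N w i => // N IH w i wN wi.
have [w0|] := posnP (len w).
  have [[|//]] := len_word w; rewrite ?w0 // big_nil => _ ->.
  by rewrite (geometric_action1 hact); exact: simple_root_nonneg.
case/len_gt0 => j [v1 [wv1 lv1]].
have ij : i != j.
  by apply/eqP => e; move: wi; rewrite wv1 e mulgenK -wv1; lia.
(* The inequality says that the lengths add up: an alternating suffix of length [k] can be split off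
   [w] without loss. *)
pose P k := `[< exists v : W, w = (v * alt (s i) (s j) k)%g /\
                          (len v + k <= len w)%N >].
have P1 : P 1%N.
  by apply/asboolP; exists v1; rewrite /= mulg1; split=> //; lia.
have Pub k : P k -> (k <= len w)%N by move=> /asboolP[v [_]]; lia.
have Pdown k d : P (k + d)%N -> P k.
  elim: d => [|d IHd]; first by rewrite addn0.
  rewrite addnS => /asboolP[v [wv lv]]; apply: IHd; apply/asboolP.
  rewrite /= in wv.
  exists (v * (if odd (k + d) then s i else s j))%g; split.
    by rewrite -mulgA.
  have := len_gen v (if odd (k + d) then i else j).
  by case: (odd _); lia.
case: (ex_maxnP (ex_intro P _ P1) Pub) => k Pk kmax.
have k0 : (0 < k)%N by exact: kmax.
have /asboolP[v [wv lv]] := Pk.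
(* This is the letter that would prolong the alternating word to the left; a descent here
   contradicts the maximality of [k]. *)
have up : (len v <= len (v * s (if odd k then i else j))%g)%N.
  rewrite leqNgt; apply/negP => lt.
  suff /kmax : P k.+1 by rewrite ltnn.
  apply/asboolP; exists (v * s (if odd k then i else j))%g; split; last by lia.
  rewrite wv /= -[in LHS](mulgenK v (if odd k then i else j)) -!mulgA.
  by case: (odd k).
(* This is the leftmost letter of the alternating word; absorbing it into a shorter [v] would make
   [w] shorter than its length. *)
have down : (len v <= len (v * s (if odd k then j else i))%g)%N.
  rewrite leqNgt; apply/negP => lt.
  have wE : (w = v * s (if odd k then j else i) * alt (s i) (s j) k.-1)%g.
    rewrite wv -[in LHS](prednK k0) /= mulgA; congr (_ * _ * _)%g.
    by rewrite -[in RHS](prednK k0) /=; case: (odd k.-1).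
  by have := len_alt (v * s (if odd k then j else i)) i j k.-1; rewrite -wE; lia.
(* Otherwise the braid relation rewrites a suffix of length [M] so that it ends in [s i], and
   [w * s i] would be shorter than [w]. *)
have bound M : m i j = Some M -> (k < M)%N.
  move=> mM; rewrite ltnNge; apply/negP => Mk.
  have /asboolP[v' [wv' lv']] : P M by apply: (@Pdown M (k - M)%N); rewrite subnKC.
  have mx := coxeter_system_matrix hW.
  have M1 := coxeter_offdiag mx ij mM.
  have br : alt (s i) (s j) M = alt (s j) (s i) M.
    apply: alt_braid; rewrite ?gen_sqr //.
      exact: (coxeter_system_rel hW mM).
    by apply: (coxeter_system_rel hW); rewrite (coxeter_sym mx).
  have wiE : (w * s i = v' * alt (s i) (s j) M.-1)%g.
    by rewrite wv' br -(prednK (ltnW M1)) altSr mulgA mulgenK.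
  by have := len_alt v' i j M.-1; rewrite -wiE; lia.
have [u1 u0] : 0 <= (cheb (- B i j) k).1 /\ 0 <= (cheb (- B i j) k).2.
  case mij: (m i j) => [M|].
    rewrite (coxeter_form_fin hB ij mij) opprK.
    apply: cheb_cos_ge0; last exact: bound.
    exact: (coxeter_offdiag (coxeter_system_matrix hW) ij mij).
  have : 1 <= - B i j by rewrite lerNr (coxeter_form_inf hB mij).
  by move/(cheb_ge1 k)/andP => [h1 h2]; split=> //; apply: le_trans h2.
rewrite wv (geometric_actionM hact) act_alt actD !actZ.
by apply: nonnegD; apply: nonnegZ => //; apply: IH => //; lia.
Qed.

(** * Positive roots *)

Definition posroot v := root_system act v /\ nonneg v.

Lemma root_act w v : root_system act v -> root_system act (act w v).
Proof.
by move=> [w' [i ->]]; exists (w * w')%g, i; rewrite (geometric_actionM hact).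
Qed.

Lemma root_opp v : root_system act v -> root_system act (- v).
Proof.
move=> [w [i ->]]; exists (w * s i)%g, i.
by rewrite (geometric_actionM hact) act_gen_simple actN.
Qed.

Lemma root_bform v : root_system act v -> bform B v v = 1.
Proof.
by move=> [w [i ->]]; rewrite bform_act bform_simple_root1.
Qed.

Lemma root_neq0 v : root_system act v -> v <> 0.
Proof.
move=> /root_bform + v0; rewrite v0 /bform mul0mx mul0mx mxE => /eqP.
by rewrite eq_sym oner_eq0.
Qed.

(** One of [w] and [w * s i] is not shortened by [s i], so [act_simple_nonneg] applies to it; the
    two send the simple root to opposite vectors. *)
Lemma root_sign v : root_system act v -> nonneg v \/ nonneg (- v).
Proof.
move=> [w [i ->]].
have [le|lt] := leqP (len w) (len (w * s i)%g).
  by left; exact: act_simple_nonneg.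
right; rewrite -actN -act_gen_simple.
rewrite -(geometric_actionM hact); apply: act_simple_nonneg.
by rewrite mulgenK ltnW.
Qed.

Lemma simple_root_root i : root_system act (simple_root i).
Proof. by exists 1%g, i; rewrite (geometric_action1 hact). Qed.

Lemma posroot_simple i : posroot (simple_root i).
Proof. by split; [exact: simple_root_root|exact: simple_root_nonneg]. Qed.

Lemma nonneg_anti v : nonneg v -> nonneg (- v) -> v = 0.
Proof.
move=> h1 h2; apply/rowP => i; apply/eqP.
by have := h2 i; rewrite !mxE oppr_ge0 eq_le h1 andbT.
Qed.

(** If [w] is nontrivial, the last letter [s i] of a reduced word is a descent, so [w] sends the
    [i]-th simple root to a negative root. *)
Lemma eq1_simple_nonneg w :
  (forall i, nonneg (act w (simple_root i))) -> w = 1%g.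
Proof.
move=> h; have [w0|] := posnP (len w).
  by have [[|//]] := len_word w; rewrite ?w0 // big_nil.
case/len_gt0 => i [v [wv lv]].
have /root_neq0 [] := root_act v (simple_root_root i).
apply: nonneg_anti.
  by apply: act_simple_nonneg; rewrite -wv ltnW.
rewrite -actN -act_gen_simple -(geometric_actionM hact) -wv.
exact: h.
Qed.

Lemma o_norm_nonneg v : nonneg v -> 0 <= o_norm o v.
Proof. by move=> h; apply: sumr_ge0 => i _; rewrite mulr_ge0 // ltW. Qed.

Lemma o_norm_nonneg_gt0 v : nonneg v -> v <> 0 -> 0 < o_norm o v.
Proof.
move=> h v0; rewrite lt_neqAle o_norm_nonneg // andbT eq_sym.
apply/eqP => e; apply: v0; apply/rowP => i; rewrite mxE.
have /eqP := e; rewrite psumr_eq0; last first.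
  by move=> j _; rewrite mulr_ge0 // ltW.
move=> /allP/(_ i (mem_index_enum _)); rewrite mulf_eq0 (gt_eqF (opos i)) /=.
by move/eqP.
Qed.

Lemma posroot_gt0 v : posroot v -> 0 < o_norm o v.
Proof. by move=> [/root_neq0 ? ?]; exact: o_norm_nonneg_gt0. Qed.

Lemma root_hat v : root_system act v -> exists2 b, posroot b & hat o v = hat o b.
Proof.
move=> rv; have [?|?] := root_sign rv; first by exists v.
exists (- v); first by split=> //; exact: root_opp.
by rewrite /hat o_normN invrN scaleNr scalerN opprK.
Qed.

(** Both roots have square 1, so [c] is 1 or -1, and positive heights exclude -1. *)
Lemma posroot_scale u v c : posroot u -> posroot v -> u = c *: v -> u = v.
Proof.
move=> pu pv e; have := root_bform pu.1.
rewrite [in bform _ _ _]e bformZl bformZr (root_bform pv.1) mulr1 => /eqP.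
rewrite -expr2 sqrf_eq1 => /orP[]/eqP c1; first by rewrite e c1 scale1r.
have := posroot_gt0 pu; rewrite e c1 scaleN1r o_normN oppr_gt0.
by rewrite ltNge ltW // posroot_gt0.
Qed.

Lemma hat_posroot_inj u v : posroot u -> posroot v -> hat o u = hat o v -> u = v.
Proof.
move=> pu pv e; apply: (posroot_scale (c := o_norm o u / o_norm o v)) => //.
by rewrite -scalerA -/(hat o v) -e /hat scalerKV ?gt_eqF ?posroot_gt0.
Qed.

Lemma root_reflection b : root_system act b -> exists r : W,
  forall v, act r v = v - (2 * bform B b v) *: b.
Proof.
move=> [w [i ->]]; exists (w * s i * w^-1)%g => v.
rewrite !(geometric_actionM hact) act_gen actD actVK.
by rewrite actN actZ -(bform_act w) actVK.
Qed.

(** The reflection changes only the [i]-th coordinate, and [v] has another positive coordinate; by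
    [root_sign] this one fixes the sign of the image. *)
Lemma posroot_gen i v : posroot v -> v <> simple_root i -> posroot (act (s i) v).
Proof.
move=> [rv nv] vi; split; first exact: root_act.
have [j ji vj] : exists2 j, j != i & 0 < v 0 j.
  apply: contrapT => h; apply: vi.
  apply: (posroot_scale (c := v 0 i)) => //; first exact: posroot_simple.
  apply/rowP => j; rewrite !mxE eqxx /=.
  have [->|ji] := eqVneq j i; first by rewrite mulr1.
  rewrite mulr0; apply/eqP; rewrite eq_le nv andbT leNgt.
  by apply/negP => vj; apply: h; exists j.
have [//|/(_ j)] := root_sign (root_act (s i) rv).
rewrite act_gen !mxE eqxx (negPf ji) /= mulr0 subr0 oppr_ge0.
by rewrite leNgt vj.
Qed.

(** * The forward light cone and its invariance under [W] *)

Definition light x := bform B x x = 0 /\ 0 < o_norm o x.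

(** This makes the normalized action well defined on [Qhat]. If a simple reflection lost the
    positive height, a point of [V_0] of nonpositive square would appear; it is zero, which makes
    [x] a multiple of a simple root, hence not isotropic. *)
Lemma light_act w x : light x -> light (act w x).
Proof.
elim/gen_ind: w x => [|i w IH] x; first by rewrite (geometric_action1 hact).
move=> /IH; rewrite (geometric_actionM hact); move: (act w x) => {}x [x0 ox].
split; first by rewrite bform_act.
rewrite ltNge; apply/negP; rewrite act_gen o_normD o_normN o_normZ.
rewrite o_norm_simple_root; set b := bform B _ _ => le0.
have oi := opos i.
(* the point of the segment [x, s_i x] on the hyperplane [V_0] *)
pose t := o_norm o x / o 0 i.
have t0 : 0 < t by rewrite divr_gt0.
have tb : t <= 2 * b by rewrite ler_pdivrMr //; lra.
have tE : o_norm o x = t * o 0 i by rewrite /t divfK // gt_eqF.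
have v0 : x - t *: simple_root i = 0.
  apply: (bform_V0_anisotropic symB hsig ho).
    by rewrite o_normD o_normN o_normZ o_norm_simple_root tE subrr.
  rewrite !(bformDl, bformDr, bformNl, bformNr, bformZl, bformZr) x0.
  by rewrite (bformC x _ symB) -/b bform_simple_root1; nra.
move: x0; have -> : x = t *: simple_root i by apply/eqP; rewrite -subr_eq0 v0.
rewrite bformZl bformZr bform_simple_root1 mulr1 => /eqP.
by rewrite mulf_eq0 orbb gt_eqF.
Qed.

(** * Finitely many positive roots of bounded height *)

Lemma o_coord_bound : exists2 b : R, 0 < b & forall i, b <= o 0 i.
Proof.
have s0 : 0 <= \sum_i (o 0 i)^-1 by apply: sumr_ge0 => i _; rewrite invr_ge0 ltW.
exists (1 + \sum_i (o 0 i)^-1)^-1; first by rewrite invr_gt0; lra.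
move=> i; rewrite -[leRHS]invrK lef_pV2 ?posrE ?invr_gt0 //; last lra.
rewrite (bigD1 i) //= addrCA lerDl addr_ge0 ?sumr_ge0 // => j _.
by rewrite invr_ge0 ltW.
Qed.

Lemma o_coord_le1 i : `|o 0 i| <= 1.
Proof.
rewrite -(@ler_pXn2r _ 2) ?nnegrE // expr1n -normrX ger0_norm ?sqr_ge0 //.
rewrite -(normalizing_unit ho) (bigD1 i) //= lerDl sumr_ge0 // => j _.
exact: sqr_ge0.
Qed.

Lemma nonneg_coord_bound (b M : R) v : 0 < b -> (forall i, b <= o 0 i) ->
  nonneg v -> o_norm o v <= M -> forall i, `|v 0 i| <= M / b.
Proof.
move=> b0 bo nv vM i; rewrite ger0_norm // ler_pdivlMr //.
apply: le_trans vM; rewrite /o_norm (bigD1 i) //= -[leLHS]addr0 lerD //.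
  by rewrite mulrC ler_wpM2r.
by apply: sumr_ge0 => j _; rewrite mulr_ge0 // ltW.
Qed.

(* [s_u s_v] is so close to the identity that it keeps [o] in the open
   fundamental chamber, and must be trivial. *)
Lemma close_posroot_eq (M : R) : 0 < M -> exists2 e : R, 0 < e &
  forall u v, posroot u -> posroot v -> o_norm o u <= M -> o_norm o v <= M ->
    (forall i, `|v 0 i - u 0 i| <= e) -> u = v.
Proof.
move=> M0; have [b b0 bo] := o_coord_bound; have [C C0 CB] := bform_bound B.
pose A := - bform B o o; have A0 : 0 < A by rewrite oppr_gt0 (bform_oo_lt0 ho).
pose K := M / b; have K0 : 0 < K by rewrite divr_gt0.
(* [e * T] will bound the deviation [D] below, and [e] is chosen so that twice this bound stays
   under every [o 0 i]. *)
pose T := M * C + (C / A + 2 * (C * K) * M) * (C * K).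
have T0 : 0 < T.
  by rewrite !(addr_gt0, mulr_gt0, divr_gt0, invr_gt0).
pose e := b / (2 * T + 1); exists e; first by rewrite divr_gt0 // addr_gt0 // mulr_gt0.
have e0 : 0 < e by rewrite divr_gt0 // addr_gt0 // mulr_gt0.
have eT : 2 * (e * T) < b.
  have : e * (2 * T + 1) = b by rewrite /e divfK // gt_eqF // addr_gt0 // mulr_gt0.
  lra.
move=> u v pu pv uM vM uv.
have uK := nonneg_coord_bound b0 bo pu.2 uM.
have u0 := posroot_gt0 pu; have v0 := posroot_gt0 pv.
have [E vE] : exists E, v = u + E by exists (v - u); rewrite addrCA subrr addr0.
have EE i : `|E 0 i| <= e by have := uv i; rewrite vE mxE addrAC subrr add0r.
have [ru ruE] := root_reflection pu.1.
have [rv rvE] := root_reflection pv.1.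
have bu := root_bform pu.1; have bv := root_bform pv.1.
have chamber i : bform B (act (ru * rv)%g o) (simple_root i) < 0.
  have dle1 : `|bform B u E| <= C * K * e by apply: CB => //; exact: ltW.
  have ole : `|o_norm o E| <= C / A * e.
    have := CB o E 1 e ler01 (ltW e0) o_coord_le1 EE.
    rewrite (bform_o ho) normrM mulr1 ltr0_norm ?(bform_oo_lt0 ho) // -/A => h.
    by rewrite mulrAC ler_pdivlMr // mulrC.
  have sle j : `|(simple_root i : 'rV[R]_n) 0 j| <= 1.
    by rewrite mxE /= ger0_norm ?ler0n // lern1 leq_b1.
  have Ele : `|bform B E (simple_root i)| <= C * e.
    by rewrite -[leRHS]mulr1; apply: CB => //; exact: ltW.
  have ule : `|bform B u (simple_root i)| <= C * K.
    by rewrite -[leRHS]mulr1; apply: CB => //; exact: ltW.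
  pose D := o_norm o v * bform B E (simple_root i)
    - (o_norm o E + 2 * bform B u E * o_norm o v) * bform B u (simple_root i).
  have -> : bform B (act (ru * rv)%g o) (simple_root i) = A * (2 * D - o 0 i).
    rewrite (geometric_actionM hact) rvE ruE.
    rewrite !(bformDl, bformDr, bformNl, bformNr, bformZl, bformZr).
    rewrite (bformC u o symB) (bformC v o symB) (bform_o ho u) (bform_o ho v).
    rewrite (bform_o ho (simple_root i)) o_norm_simple_root.
    rewrite -(opprK (bform B o o)) -/A.
    by rewrite /D vE !(bformDl, bformDr, o_normD) bu; ring.
  have Dle : `|D| <= e * T.
    rewrite /D (le_trans (ler_normB _ _)) // mulrDr lerD //.
      rewrite normrM (gtr0_norm v0) (_ : e * (M * C) = M * (C * e)); last by ring.
      by rewrite ler_pM // ltW.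
    rewrite normrM mulrA ler_pM //.
    rewrite (le_trans (ler_normD _ _)) // mulrDr lerD //; first by rewrite mulrC.
    rewrite !normrM (@ger0_norm _ 2) // (gtr0_norm v0).
    rewrite (_ : e * _ = 2 * (C * K * e) * M); last by ring.
    by rewrite !ler_pM ?mulr_ge0 // ltW.
  have Dle' := le_trans (ler_norm D) Dle.
  have := bo i; rewrite pmulr_rlt0 //; lra.
(* Pairing with [o] has the sign opposite to the height, so by [chamber] the inverse sends every
   simple root to a root of positive height. *)
have w1 : ((ru * rv)^-1 = 1)%g.
  apply: eq1_simple_nonneg => i.
  have [//|neg] := root_sign (root_act (ru * rv)^-1%g (simple_root_root i)).
  have := chamber i; rewrite -(bform_act (ru * rv)^-1%g) actK.
  rewrite (bform_o ho) nmulr_rlt0 ?(bform_oo_lt0 ho) // => pos.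
  have := o_norm_nonneg neg; rewrite o_normN oppr_ge0.
  by rewrite leNgt pos.
(* Since [rv] negates [v], this says that [ru] negates [v] as well, so [v] is proportional to
   [u]. *)
have : act (ru * rv)%g v = v.
  by rewrite -[RHS](actVK (ru * rv)%g) w1 (geometric_action1 hact).
rewrite (geometric_actionM hact) rvE bv mulr1 scaler_nat mulr2n opprD addrA subrr.
rewrite sub0r ruE bformNr => fixv.
symmetry; apply: (posroot_scale (c := bform B u v)) => //.
have vv : v + v = (2 * bform B u v) *: u.
  by rewrite -{1}fixv mulrN scaleNr opprK addrAC addNr add0r.
have vh : v = 2^-1 *: (v + v).
  by rewrite -[v + v]mulr2n -[v *+ 2]scaler_nat scalerA mulVf ?pnatr_eq0 // scale1r.
by rewrite [LHS]vh vv scalerA mulKf ?pnatr_eq0.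
Qed.

(** Pigeonhole: these roots lie in a bounded box, cut into cubes of side [e], and by
    [close_posroot_eq] each cube contains at most one of them. *)
Lemma finite_posroot_le (M : R) : finite_set [set v | posroot v /\ o_norm o v <= M].
Proof.
have [M0|M0] := leP M 0.
  rewrite (_ : [set _ | _] = set0) //; apply/seteqP; split=> // v /= [pv vM].
  by have := posroot_gt0 pv; rewrite ltNge (le_trans vM M0).
have [b b0 bo] := o_coord_bound; have [e e0 He] := close_posroot_eq M0.
set S := [set _ | _]; pose N := Num.truncn (M / b / e).
pose f v : {ffun 'I_n -> 'I_N.+1} := [ffun i => inord (Num.truncn (v 0 i / e))].
have fS : {in S &, injective f}.
  move=> u v; rewrite !inE => -[pu uM] [pv vM] fuv; apply: He => // i.
  have val x : posroot x -> o_norm o x <= M ->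
      (f x i : nat) = Num.truncn (x 0 i / e).
    move=> px xM; rewrite ffunE inordK // ltnS; apply: le_truncn.
    rewrite ler_pM2r ?invr_gt0 //; apply: le_trans (ler_norm _) _.
    exact: nonneg_coord_bound px.2 xM i.
  have itv x : posroot x -> o_norm o x <= M ->
      (f x i)%:R <= x 0 i / e < (f x i)%:R + 1.
    move=> px xM; rewrite val // natr1; apply: truncn_itv.
    by rewrite divr_ge0 ?px.2 // ltW.
  have /andP[h1 h2] := itv u pu uM; have /andP[h3 h4] := itv v pv vM.
  rewrite fuv in h1 h2.
  have : `|v 0 i / e - u 0 i / e| <= 1 by rewrite ler_norml; lra.
  by rewrite -mulrBl normrM (gtr0_norm (x := e^-1)) ?invr_gt0 // ler_pdivrMr // mul1r.
rewrite -(eq_finite_set (inj_card_eq fS)).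
exact: finite_finset.
Qed.

Lemma posroot_seq_height (b : nat -> 'rV[R]_n) (M : R) :
  injective b -> (forall k, posroot (b k)) ->
  \forall k \near \oo, M < o_norm o (b k).
Proof.
move=> binj pb.
have : finite_set (b @^-1` [set v | posroot v /\ o_norm o v <= M]).
  by apply: finite_preimage (finite_posroot_le M) => k l _ _; exact: binj.
move=> /finite_seqP[r rE]; exists (\max_(k <- r) k).+1 => //= k /= rk.
rewrite ltNge; apply/negP => le.
have /leq_bigmax_seq : k \in r by have : [set` r] k by rewrite -rE.
by move=> /(_ xpredT id isT); rewrite leqNgt rk.
Qed.

(** * Limit roots are the points of [Qhat] with nonnegative orbit *)

Lemma Qhat_light x : Qhat B o x -> light x.
Proof. by case=> ox x0; split=> //; rewrite ox ltr01. Qed.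

Lemma hat_light x : light x -> Qhat B o (hat o x).
Proof.
move=> [x0 ox]; split; first by rewrite o_normZ mulVf // gt_eqF.
by rewrite bformZl bformZr x0 !mulr0.
Qed.

Lemma limit_root_seq x : limit_roots act o x ->
  exists b : nat -> 'rV[R]_n, [/\ injective b, forall k, posroot (b k)
    & hat o (b k) @[k --> \oo] --> x].
Proof.
move=> [u [uinj ur ux]].
have /choice[b bP] : forall k, exists b, posroot b /\ u k = hat o b.
  move=> k; have [v rv <-] := ur k.
  by have [b pb e] := root_hat rv; exists b.
exists b; split=> [k l e|k|]; first by apply: uinj; rewrite !(bP _).2 e.
  exact: (bP k).1.
by rewrite (_ : (fun k => hat o (b k)) = u) //; apply/funext => k; rewrite (bP k).2.
Qed.

Lemma cvg_act w (u : nat -> 'rV[R]_n) v : u k @[k --> \oo] --> v ->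
  act w (u k) @[k --> \oo] --> act w v.
Proof.
move=> /cvg_rowP uv; apply/cvg_rowP => j.
have actE x : act w x 0 j = \sum_i x 0 i * act w (simple_root i) 0 j.
  rewrite [in LHS](row_sum_delta x).
  rewrite (big_morph _ (actD w) (act0 w)) summxE.
  by apply: eq_bigr => i _; rewrite actZ mxE.
rewrite actE; under eq_fun do rewrite actE.
by apply: cvg_sum_seq => i; apply: cvgM => //; exact: cvg_cst.
Qed.

Lemma limit_root_Qhat x : limit_roots act o x -> Qhat B o x.
Proof.
case/limit_root_seq => b [binj pb bx].
have h0 k := posroot_gt0 (pb k).
have o1 k : o_norm o (hat o (b k)) = 1 by rewrite o_normZ mulVf ?gt_eqF.
have o1_cvg : o_norm o (hat o (b k)) @[k --> \oo] --> (1 : R).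
  by under eq_fun do rewrite o1; exact: cvg_cst.
have ox : o_norm o x = 1.
  exact: (cvg_unique (@Rhausdorff R) (cvg_o_norm (o := o) bx) o1_cvg).
split=> //; apply: (cvg_unique (@Rhausdorff R) (cvg_bform (B := B) bx)).
apply/cvgrPdist_lt => e e0.
near=> k.
rewrite sub0r normrN /hat bformZl bformZr (root_bform (pb k).1) mulr1.
(* Height above 1 bounds the squared inverse height by the inverse height, which is below [e] once
   the height exceeds [e^-1]. *)
have : Num.max 1 e^-1 < o_norm o (b k).
  by near: k; apply: posroot_seq_height.
rewrite gt_max => /andP[h1 he].
rewrite ger0_norm ?mulr_ge0 ?invr_ge0 ?ltW //.
apply: (@le_lt_trans _ _ (o_norm o (b k))^-1).
  by rewrite ler_piMl ?invr_ge0 ?(ltW (h0 k)) // invf_le1 // ltW.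
by rewrite -[ltRHS]invrK ltf_pV2 ?posrE ?invr_gt0.
Unshelve. all: by end_near. Qed.

(** The image has positive height, hence a positive coordinate. A negative one besides it would give
    mixed signs to the images of roots close to the limit, against [root_sign]. *)
Lemma limit_root_nonneg x w : limit_roots act o x -> nonneg (act w x).
Proof.
move=> Lx; have [x0 wx] := light_act w (Qhat_light (limit_root_Qhat Lx)).
have [b [binj pb bx]] := limit_root_seq Lx.
have [j wj] : exists j, 0 < act w x 0 j.
  apply: contrapT => h; move: wx; rewrite ltNge => /negP; apply.
  apply: sumr_le0 => i _; rewrite pmulr_rle0 // leNgt.
  by apply/negP => ?; apply: h; exists i.
move=> i; rewrite leNgt; apply/negP => wi.
have /cvg_rowP cw := cvg_act (w := w) bx.
have Hj : \forall k \near \oo, 0 < act w (hat o (b k)) 0 j.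
  exact: (cvgr_gt _ (cw j)).
have Hi : \forall k \near \oo, act w (hat o (b k)) 0 i < 0.
  exact: (cvgr_lt _ (cw i)).
have [k [/= hj hi]] := filter_ex (filterI Hj Hi).
move: hj hi; rewrite actZ !mxE.
have h0 : 0 < (o_norm o (b k))^-1 by rewrite invr_gt0 (posroot_gt0 (pb k)).
rewrite pmulr_rgt0 // pmulr_rlt0 // => hj hi.
have [/(_ i)|/(_ j)] := root_sign (root_act w (pb k).1).
  by rewrite leNgt hi.
by rewrite mxE oppr_ge0 leNgt hj.
Qed.

(* If [0 <= B x b] then [v = hat b - x], which lies in [V_0], has
   [B v v <= (o_norm b)^-2]. *)
Lemma limit_root_of_infinite x : Qhat B o x ->
  infinite_set [set b | posroot b /\ 0 <= bform B x b] -> limit_roots act o x.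
Proof.
move=> [ox x0] /infiniteP/pcard_leP[b].
have binj : injective b by move=> k l; apply: inj; rewrite inE.
have bP k : posroot (b k) /\ 0 <= bform B x (b k).
  by have := @funS _ _ _ _ b k; apply.
exists (fun k => hat o (b k)); split.
- move=> k l /(hat_posroot_inj (bP k).1 (bP l).1); exact: binj.
- by move=> k; exists (b k) => //; exact: (bP k).1.1.
have [c [c0 cP]] := coord_V0_bound symB hsig ho.
apply/cvg_rowP => i; apply/cvgrPdist_lt => e e0.
near=> k.
have : Num.max 1 (c / e ^+ 2) < o_norm o (b k).
  by near: k; apply: posroot_seq_height => // k; exact: (bP k).1.
have h0 := posroot_gt0 (bP k).1.
set h := o_norm o (b k) in h0 *.
rewrite gt_max => /andP[h1 he].
pose v := hat o (b k) - x.
have v0 : o_norm o v = 0.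
  by rewrite o_normD o_normN /hat o_normZ -/h mulVf ?gt_eqF // ox subrr.
have vv : bform B v v <= h^-1 ^+ 2.
  rewrite !(bformDl, bformDr, bformNl, bformNr, bformZl, bformZr) x0.
  rewrite (root_bform (bP k).1.1) (bformC _ x symB) -/h.
  have := (bP k).2; have : 0 <= h^-1 by rewrite invr_ge0 ltW.
  move: (h^-1) (bform _ _ _) => z y z0 y0.
  by have := mulr_ge0 z0 y0; lra.
have norm_lt (z : R) : z ^+ 2 < e ^+ 2 -> `|z| < e.
  by rewrite -real_normK ?num_real // ltr_pXn2r // ?nnegrE ?ltW.
rewrite distrC (_ : _ - _ = v 0 i); last by rewrite !mxE.
apply: norm_lt; apply: le_lt_trans (cP v i v0) _; apply: (@le_lt_trans _ _ (c * h^-1)).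
  rewrite ler_wpM2l ?(ltW c0) // (le_trans vv) // expr2 ler_piMl ?invr_ge0 ?(ltW h0) //.
  by rewrite invf_le1 // ltW.
by rewrite ltr_pdivrMr // mulrC -ltr_pdivrMr ?exprn_gt0.
Unshelve. all: by end_near. Qed.

(** The size of [l] carries the descent: [s i] permutes the positive roots other than the [i]-th
    simple root, and the latter pairs negatively with the reflected point, so it leaves the list. *)
Lemma light_posroots_not_finite x (l : seq 'rV[R]_n) :
  light x -> (forall w, nonneg (act w x)) ->
  ~ (forall b, posroot b -> 0 <= bform B x b -> b \in l).
Proof.
have [N] := ubnP (size l); elim: N x l => // N IH x l lN Lx wx Fl.
have [[i xi]|desc] := pselect (exists i, 0 < bform B x (simple_root i)).
  have ail : simple_root i \in l.
    by apply: Fl; [exact: posroot_simple|exact: ltW].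
  pose l' := map (act (s i)) (rem (simple_root i) l).
  apply: (IH (act (s i) x) l').
  - rewrite size_map size_rem //; move: lN ail; case: (l) => //= *; lia.
  - exact: light_act.
  - by move=> w; rewrite -(geometric_actionM hact).
  move=> b pb; have -> : b = act (s i) (act (s i) b).
    by rewrite -(geometric_actionM hact) gen_sqr (geometric_action1 hact).
  rewrite bform_act => xb.
  have nb : b <> simple_root i.
    move=> e; move: xb; rewrite e act_gen_simple bformNr oppr_ge0.
    by rewrite leNgt xi.
  have pb' := posroot_gen pb nb.
  apply: map_f; have := Fl _ pb' xb.
  have neq : act (s i) b != simple_root i.
    apply/eqP => e; have /(_ i) := pb.2.
    have -> : b = - simple_root i.
      rewrite -act_gen_simple -e -(geometric_actionM hact) gen_sqr.
      by rewrite (geometric_action1 hact).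
    by rewrite !mxE !eqxx /= oppr_ge0 ler10.
  exact: rem_mem.
have xnn : nonneg x by have := wx 1%g; rewrite (geometric_action1 hact).
have xle i : bform B x (simple_root i) <= 0.
  by rewrite leNgt; apply/negP => xi; apply: desc; exists i.
have supp i : 0 < x 0 i -> bform B x (simple_root i) = 0.
  move=> xi; have := Lx.1; rewrite bform_suml => /eqP.
  rewrite -oppr_eq0 -sumrN psumr_eq0; last first.
    by move=> j _; rewrite oppr_ge0 (bformC _ _ symB) mulr_ge0_le0.
  move=> /allP/(_ i (mem_index_enum _)).
  by rewrite oppr_eq0 mulf_eq0 (gt_eqF xi) (bformC _ _ symB) => /eqP.
(* No descent is left. The roots in [T], supported on the support of [x], are orthogonal to [x], so
   they all lie in [l] and one of them is highest. *)
pose T b := posroot b /\ forall i, x 0 i = 0 -> b 0 i = 0.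
have xT b : T b -> bform B x b = 0.
  move=> [pb bx]; rewrite (bformC _ _ symB) bform_suml big1 // => i _.
  have [/bx->|xi] := eqVneq (x 0 i) 0; first by rewrite mul0r.
  by rewrite (bformC _ _ symB) supp ?mulr0 // lt_neqAle eq_sym xi xnn.
have [i0 xi0] : exists i, 0 < x 0 i.
  apply: contrapT => h; have := Lx.2; rewrite ltNge => /negP; apply.
  by apply: sumr_le0 => i _; rewrite pmulr_rle0 // leNgt; apply/negP => ?; apply: h; exists i.
have Ti0 : T (simple_root i0).
  split; first exact: posroot_simple.
  move=> i xi; rewrite !mxE /=; case: eqP => // e; move: xi0; rewrite -e xi ltxx //.
have Tl b : T b -> b \in l by move=> Tb; apply: Fl; [exact: Tb.1|rewrite xT].
have /(seq_argmax (o_norm o))[b Tb bmax] : exists2 b, b \in l & T b.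
  by exists (simple_root i0) => //; exact: Tl.
(* A negative pairing would make the reflection of [b] a higher root in [T]. *)
have bge i : 0 < x 0 i -> 0 <= bform B b (simple_root i).
  move=> xi; rewrite leNgt; apply/negP => neg.
  have Ts : T (act (s i) b).
    have pos : 0 <= - (2 * bform B (simple_root i) b).
      by rewrite (bformC _ _ symB); lra.
    rewrite act_gen -scaleNr; split; last first.
      move=> j xj; rewrite !mxE (Tb.2 j xj) eqxx /=; case: eqP => [e|].
        by move: xi; rewrite -e xj ltxx.
      by rewrite mulr0 addr0.
    split; first by rewrite scaleNr -act_gen; apply: root_act; exact: Tb.1.1.
    by apply: nonnegD; [exact: Tb.1.2|apply: nonnegZ => //; exact: simple_root_nonneg].
  have := bmax _ (Tl _ Ts) Ts.
  rewrite act_gen o_normD o_normN o_normZ o_norm_simple_root.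
  by rewrite (bformC _ _ symB) leNgt; have := opos i; nra.
(* [bform B x b = 0] is now a sum of nonnegative terms, so each of them vanishes. *)
have b0 i : 0 < x 0 i -> bform B (simple_root i) b = 0.
  move=> xi; have := xT b Tb; rewrite bform_suml => /eqP.
  rewrite psumr_eq0; last first.
    move=> j _; have [->|xj] := eqVneq (x 0 j) 0; first by rewrite mul0r.
    by rewrite mulr_ge0 // (bformC _ _ symB) bge // lt_neqAle eq_sym xj xnn.
  move=> /allP/(_ i (mem_index_enum _)).
  by rewrite mulf_eq0 (gt_eqF xi) => /eqP.
have := root_bform Tb.1.1; rewrite bform_suml big1 => [/eqP|i _].
  by rewrite eq_sym oner_eq0.
have [/Tb.2->|xi] := eqVneq (x 0 i) 0; first by rewrite mul0r.
by rewrite b0 ?mulr0 // lt_neqAle eq_sym xi xnn.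
Qed.

Lemma limit_rootsE : limit_roots act o =
  [set x | Qhat B o x /\ forall w, nonneg (act w x)].
Proof.
apply/seteqP; split=> x /=.
  by move=> Lx; split=> [|w]; [exact: limit_root_Qhat|exact: limit_root_nonneg].
move=> [Qx wx]; apply: limit_root_of_infinite => // /finite_seqP[l lE].
apply: (@light_posroots_not_finite x l) => //; first exact: Qhat_light.
move=> b pb xb; have : [set b | posroot b /\ 0 <= bform B x b] b by [].
by rewrite lE.
Qed.

Lemma hat_nonneg v : 0 < o_norm o v -> nonneg (hat o v) -> nonneg v.
Proof.
move=> v0 h; rewrite (_ : v = o_norm o v *: hat o v).
  by apply: nonnegZ => //; exact: ltW.
by rewrite /hat scalerKV // gt_eqF.
Qed.

(** By [convex_hullP], [act w x] has a negative coordinate exactly when its normalization leaves the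
    hull; then [x] is the image under [w^-1] of a point outside. *)
Lemma limit_roots_orbits : limit_roots act o = Qhat B o `\`
  normalized_orbit act o (Qhat B o `\` convex_hull (hat o @` simple_roots)).
Proof.
rewrite limit_rootsE; apply/seteqP; split=> x /= [Qx wx].
  split=> // -[w [y [Qy yN] xE]]; apply: yN; apply/(convex_hullP ho Qy.1).
  have [_ wy] := light_act w (Qhat_light Qy).
  have := wx (w^-1)%g; rewrite xE actZ actK => h i.
  by have := h i; rewrite mxE pmulr_rge0 ?invr_gt0.
split=> // w; apply: contrapT => wN; apply: wx.
have lw := light_act w (Qhat_light Qx).
have Qw := hat_light lw.
exists (w^-1)%g, (hat o (act w x)).
  split=> // /(convex_hullP ho Qw.1) h; apply: wN; exact: hat_nonneg lw.2 h.
rewrite /hat actZ actK o_normZ Qx.1 mulr1 invrK scalerKV //.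
by rewrite gt_eqF // lw.2.
Qed.

End LimitRoots.

Theorem theorem1p2 (R : realType) (n : nat)
    (m : 'I_n -> 'I_n -> option nat) (W : groupType) (s : 'I_n -> W)
    (B : 'M[R]_n) (act : W -> 'rV[R]_n -> 'rV[R]_n) (o : 'rV[R]_n)
    (hW : coxeter_system m s)
    (hirr : irreducible_coxeter m)
    (hinf : infinite_set [set: W])
    (hB : coxeter_form m B)
    (hsig : has_signature n.-1 1 B)
    (hact : geometric_action s B act)
    (ho : normalizing_vector B o) :
  (Qhat B o `<=` convex_hull (hat o @` simple_roots) ->
     limit_roots act o = Qhat B o) /\
  (~ (Qhat B o `<=` convex_hull (hat o @` simple_roots)) ->
     exists (k : nat) (D : 'I_k -> set 'rV[R]_n),
       [/\ (1 <= k <= n)%N,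
           injective D,
           range D = connected_components
                       (Qhat B o `\` convex_hull (hat o @` simple_roots))
         & limit_roots act o =
             Qhat B o `\` \bigcup_(i in [set: 'I_k]) normalized_orbit act o (D i)]).
Proof.
have LE := limit_roots_orbits hW hB hsig hact ho.
set S := Qhat B o `\` convex_hull _ in LE *.
split=> [|Qhull].
  rewrite -setD_eq0 => S0.
  by rewrite LE /S S0; apply/seteqP; split=> [x []//|x Qx]; split=> // -[w [y []]].
have [k [D [kn Dinj DS]]] :=
  components_outside_hull (coxeter_form_sym hB) hsig ho.
exists k, D; split=> //.
  rewrite kn andbT; have [x Sx] : S !=set0.
    by apply/set0P/eqP => S0; apply: Qhull; rewrite -setD_eq0.
  have : range D (connected_component S x) by rewrite DS; exists x.
  by move=> [i _ _]; exact: leq_trans (ltn_ord i).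
(* The components cover [S], so the orbit of [S] is the union of their orbits. *)
rewrite LE; congr (_ `\` _); apply/seteqP; split=> y.
  move=> [w [x Sx ->]]; have : range D (connected_component S x).
    by rewrite DS; exists x.
  move=> [i _ Di]; exists i => //; exists w, x => //.
  by rewrite Di; exact: connected_component_refl.
move=> [i _ [w [x Dx ->]]]; exists w, x => //.
have : connected_components S (D i) by rewrite -DS; exists i.
by move=> [z _ Dz]; move: Dx; rewrite -Dz => /connected_component_sub.
Qed.
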